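(* Let $\mathcal{H}$ be a real Hilbert space, let $\mathcal{T}:\mathcal{H}\to 2^{\mathcal{H}}$ be a maximal monotone operator with $\mathcal{T}^{-1}(0)\neq\emptyset$, and let $\mathcal{M}$ be an admissible preconditioner for $\mathcal{T}$ with closed range. Let $w^0\in\mathcal{H}$, $\alpha\ge2$, $\rho\in(0,2]$. Then the sequences $\{w^k\}$ and $\{\hat w^k\}$ generated by the accelerated degenerate proximal point method (accelerated dPPM) described in the context satisfy the following: (a) if $\alpha=2$, then $$\|w^k-\hat w^{k+1}\|_{\mathcal{M}}\le\frac{2\|w^0-w^*\|_{\mathcal{M}}}{k+1},\qquad\forall k\ge0\ \text{and}\ w^*\in\mathcal{T}^{-1}(0);$$ (b) if $\alpha>2$, then $$\|w^{k+1}-w^k\|_{\mathcal{M}}=o\left(\frac{1}{k+1}\right)\quad\text{and}\quad\|w^k-\hat w^{k+1}\|_{\mathcal{M}}=o\left(\frac{1}{k+1}\right)\quad\text{as }k\to+\infty.$$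
   Context: $\mathcal{H}$ is a real Hilbert space with inner product $\langle\cdot,\cdot\rangle$; $\mathcal{T}^{-1}(0)=\{w\in\mathcal{H}:0\in\mathcal{T}w\}$; $\|w\|_{\mathcal{M}}:=\sqrt{\langle w,\mathcal{M}w\rangle}$ (a seminorm). Admissible preconditioner: an admissible preconditioner for $\mathcal{T}:\mathcal{H}\to 2^{\mathcal{H}}$ is a linear, bounded, self-adjoint, positive semidefinite operator $\mathcal{M}:\mathcal{H}\to\mathcal{H}$ such that $\widehat{\mathcal{T}}:=(\mathcal{M}+\mathcal{T})^{-1}\mathcal{M}$ is single-valued and has full domain. Accelerated dPPM: given $w^0\in\mathcal{H}$, $\hat w^0=w^0$, $\alpha\ge 2$ and $\rho\in(0,2]$, for $k=0,1,\ldots$ set 1. $\bar w^k=\widehat{\mathcal{T}}w^k$; 2. $\hat w^{k+1}=(1-\rho)w^k+\rho\bar w^k$; 3. $w^{k+1}=w^k+\frac{\alpha}{2(k+\alpha)}(\hat w^{k+1}-w^k)+\frac{k}{k+\alpha}(\hat w^{k+1}-\hat w^k)$. *)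

(* Defs.v *)
From HB Require Import structures.
From mathcomp Require Import all_boot all_order all_algebra.
From mathcomp Require Import all_classical all_reals all_analysis.

Set Implicit Arguments.
Unset Strict Implicit.
Unset Printing Implicit Defensive.

Import Order.TTheory GRing.Theory Num.Theory.
Import numFieldNormedType.Exports.

Local Open Scope classical_set_scope.
Local Open Scope ring_scope.

(* A real Hilbert space: a complete normed module whose norm comes from an
   inner product; [{dot H for idfun}] is the type of symmetric, bilinear,
   positive definite forms on [H]. *)
HB.mixin Record CompleteNormedModule_isHilbert (R : realType) H
    of CompleteNormedModule R H := {
  inner : {dot H for idfun} ;
  norm_inner : forall u : H, `|u| = Num.sqrt (inner u u)
}.

#[short(type="hilbertType")]
HB.structure Definition Hilbert (R : realType) :=
  {H of CompleteNormedModule R H & CompleteNormedModule_isHilbert R H}.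

(* Set-valued operators [H -> 2^H] are functions [H -> set H]; [T w v] reads
   "[v] belongs to [T w]". *)
Section set_valued_operators.
Context {R : realType} {H : hilbertType R}.
Implicit Types (T S : H -> set H) (f : H -> H).

Definition monotone T :=
  forall u v x y : H, T u x -> T v y -> 0 <= inner (u - v) (x - y) :> R.

Definition maximal_monotone T :=
  monotone T /\
  forall S, monotone S -> (forall u, T u `<=` S u) -> forall u, S u = T u.

Definition zeros T : set H := [set w | T w 0].

Definition op_add f T : H -> set H := fun u => [set f u + x | x in T u].

Definition op_inv T : H -> set H := fun y => [set u | T u y].

Definition single_valued T := forall w u v, T w u -> T w v -> u = v.

Definition full_domain T := forall w, T w !=set0.

End set_valued_operators.

Section preconditioners.
Context {R : realType} {H : hilbertType R}.
Implicit Types (T : H -> set H) (M : {linear H -> H}).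

Definition bounded_operator M :=
  exists C : R, forall u, `|M u| <= C * `|u|.

Definition self_adjoint M :=
  forall u v, inner (M u) v = inner u (M v) :> R.

Definition positive_semidefinite M := forall u, 0 <= inner u (M u) :> R.

(* (M + T)^-1 M *)
Definition preconditioned M T : H -> set H :=
  fun w => op_inv (op_add M T) (M w).

Definition admissible_preconditioner M T :=
  [/\ bounded_operator M, self_adjoint M, positive_semidefinite M,
      single_valued (preconditioned M T) & full_domain (preconditioned M T)].

Definition mnorm M (w : H) : R := Num.sqrt (inner w (M w)).

(* The triple of sequences [w], [wbar], [what] is a run of the method started
   at [w0].  For an admissible preconditioner the first recurrence determines
   [wbar k], so that there is exactly one such triple. *)
Definition accelerated_dPPM M T (w0 : H) (alpha rho : R)
    (w wbar what : nat -> H) :=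
  [/\ w 0%N = w0, what 0%N = w0 &
   forall k : nat,
     [/\ preconditioned M T (w k) (wbar k),
         what k.+1 = (1 - rho) *: w k + rho *: wbar k &
         w k.+1 = w k + (alpha / (2 * (k%:R + alpha))) *: (what k.+1 - w k)
                      + (k%:R / (k%:R + alpha)) *: (what k.+1 - what k)]].

End preconditioners.

(* Main.v *)
(** Write <u,v>_M for <u, M v>, V_k = (w^k - what^{k+1}) / 2 and
    Y_k = w^{k+1} - w^k + V_k.  The recurrence is Y_0 = 0 and, with n = k+1,
    (n + alpha) Y_{k+1} = n (Y_k - V_{k+1} + V_k); monotonicity of T and
    rho <= 2 give <V_{k+1} - V_k, Y_k - V_{k+1}>_M >= 0 and
    <V_k, w^k - w*>_M >= |V_k|_M^2.  Put lam = alpha - 1 and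
    U_k = lam (w^k - w* ) + (n + lam) Y_k + (n - lam) V_k.  The energy
    E_k = |U_k|_M^2 / 2 - n (n + lam) <Y_k, V_k>_M dominates
    n^2 |V_k|_M^2 / 2 and decreases by at least
    (alpha - 2) (n + 1) |V_{k+1}|_M^2 at each step.
    For alpha = 2, E_0 = |w^0 - w*|_M^2 / 2, which is (a).
    For alpha > 2, let h_k = (k+1)^2 (|Y_k|_M^2 + |V_k|_M^2).  For a suitable
    c, h + c E decreases at each step by at least h_{k+1} / (k+2).  Hence h
    converges, and its limit is 0 because the harmonic series diverges; this
    is (b). *)

Require Import Defs.
From HB Require Import structures.
From mathcomp Require Import all_boot all_order all_algebra.
From mathcomp Require Import all_classical all_reals all_analysis.
From mathcomp Require Import ring lra.

Set Implicit Arguments.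
Unset Strict Implicit.
Unset Printing Implicit Defensive.

Import Order.TTheory GRing.Theory Num.Theory.
Import numFieldNormedType.Exports.
Local Open Scope classical_set_scope.
Local Open Scope ring_scope.

(** * Descent of real sequences *)

Lemma nonincreasing_ge0_is_cvgn (R : realType) (u : R^nat) :
  (forall k, 0 <= u k) -> (forall k, u k.+1 <= u k) -> cvgn u.
Proof.
move=> u0 u_dec; apply: nonincreasing_is_cvgn; first exact/nonincreasing_seqP.
by exists 0 => _ [k _ <-].
Qed.

Lemma descent_cvg0 (R : realType) (E h : R^nat) :
  (forall k, 0 <= E k) -> (forall k, 0 <= h k) -> (forall k, E k.+1 <= E k) ->
  (forall k, h k.+1 + E k.+1 + h k.+1 / k.+2%:R <= h k + E k) ->
  h @ \oo --> 0.
Proof.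
move=> E0 h0 E_dec hE_dec.
have E_cvg : cvgn E by exact: nonincreasing_ge0_is_cvgn.
have hE_cvg : cvgn (h \+ E).
  apply: nonincreasing_ge0_is_cvgn => k /=; first by rewrite addr_ge0.
  by apply: le_trans (hE_dec k); rewrite lerDl divr_ge0.
have h_cvg : cvgn h.
  have -> : h = (h \+ E) - E by rewrite funeqE => k; rewrite !fctE addrK.
  exact: is_cvgB.
have : 0 <= limn h by apply: limr_ge => //; exact: nearW.
rewrite le_eqVlt => /predU1P[->//|L0]; exfalso; set L := limn h in L0.
have [N _ hN] : \forall k \near \oo, L / 2 < h k.
  by apply: cvgr_gt h_cvg _ _; rewrite ltr_pdivrMr// ltr_pMr// ltr1n.
(* Telescoping [hE_dec] from N: the drop [h k.+1 / k.+2%:R] is at least L / 2 times [harmonic k.+1],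
   so the sum starts at N + 1. A bounded tail of the harmonic series is the contradiction. *)
have sum_le m : \sum_(N.+1 <= k < N.+1 + m) harmonic k * (L / 2)
    + (h (N + m)%N + E (N + m)%N) <= h N + E N.
  elim: m => [|m IHm]; first by rewrite !addn0 big_geq// add0r.
  apply: le_trans IHm; rewrite addnS big_nat_recr ?leq_addr//= -addrA lerD2l.
  rewrite addnS addSn; apply: le_trans (hE_dec _).
  rewrite [leRHS]addrC lerD2r mulrC ler_wpM2r ?invr_ge0//.
  by apply/ltW/hN; rewrite /= -addnS leq_addr.
apply: (@dvg_harmonic R); rewrite -(is_cvg_series_restrict N.+1).
apply: nondecreasing_is_cvgn.
  by apply: (@nondecreasing_series _ _ xpredT) => k _ _; exact: harmonic_ge0.
exists ((h N + E N) / (L / 2)) => _ [n _ <-] /=.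
rewrite ler_pdivlMr; last by lra.
have [nN|/ltnW/subnKC] := leqP n N.+1.
  by rewrite big_geq// mul0r addr_ge0.
move: (n - N.+1)%N => m <-; rewrite mulr_suml.
apply: le_trans (sum_le m).
by rewrite lerDl addr_ge0.
Qed.

(** * One-step inequalities in the semi-inner product of M *)

Section mdot.
Context {R : realType} {H : hilbertType R} (M : {linear H -> H}).
Implicit Types (u v x Y V : H) (a n lam : R).

Definition mdot u v : R := inner u (M v).

Lemma mdotDl u v z : mdot (u + v) z = mdot u z + mdot v z.
Proof. exact: linearDl. Qed.

Lemma mdotZl a u z : mdot (a *: u) z = a * mdot u z.
Proof. exact: linearZl_LR. Qed.

Lemma mdotNl u z : mdot (- u) z = - mdot u z.
Proof. exact: linearNl. Qed.

Lemma mdotDr z u v : mdot z (u + v) = mdot z u + mdot z v.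
Proof. by rewrite /mdot linearD; exact: linearDr. Qed.

Lemma mdotZr a z u : mdot z (a *: u) = a * mdot z u.
Proof. by rewrite /mdot linearZ; exact: linearZr_LR. Qed.

Lemma mdotNr z u : mdot z (- u) = - mdot z u.
Proof. by rewrite /mdot linearN; exact: linearNr. Qed.

Definition mdotE := (mdotDl, mdotDr, mdotNl, mdotNr, mdotZl, mdotZr).

Lemma inner_sym u v : inner u v = inner v u :> R.
Proof. by rewrite hermC expr0 mul1r. Qed.

Hypotheses (M_sa : self_adjoint M) (M_psd : positive_semidefinite M).

Lemma mdotC u v : mdot u v = mdot v u.
Proof. by rewrite /mdot -M_sa inner_sym. Qed.

Lemma mdot_ge0 u : 0 <= mdot u u. Proof. exact: M_psd. Qed.

(* [U' = U - (lam - 1) *: V'] along a step of the method. *)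
Definition energy lam n x Y V : R :=
  let U := lam *: x + (n + lam) *: Y + (n - lam) *: V in
  2^-1 * mdot U U - n * (n + lam) * mdot Y V.

(** Expanding with U' = U - (lam - 1) V' turns the gap between the two sides into a nonnegative
    combination of the two hypotheses' slacks and |V'|^2. *)
Lemma energy_step lam n x Y V V' (Y' := (n / (n + lam + 1)) *: (Y - V' + V)) :
  1 <= lam -> 0 < n -> 0 <= mdot (V' - V) (Y - V') ->
  mdot V' V' <= mdot V' (x + Y - V) ->
  energy lam (n + 1) (x + Y - V) Y' V' + (lam - 1) * (n + 1) * mdot V' V'
    <= energy lam n x Y V.
Proof.
move=> lam1 n0 c1 c2.
rewrite -subr_ge0.
suff -> : energy lam n x Y V -
   (energy lam (n + 1) (x + Y - V) Y' V' + (lam - 1) * (n + 1) * mdot V' V') =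
   n * (n + lam) * mdot (V' - V) (Y - V')
   + lam * (lam - 1) * (mdot V' (x + Y - V) - mdot V' V')
   + 2^-1 * (lam - 1) ^+ 2 * mdot V' V'.
  have := mdot_ge0 V'; move: c1 c2; set p := mdot _ _; set q := mdot _ _.
  set r := mdot _ _ => p0 q0 r0.
  by rewrite !addr_ge0// !mulr_ge0 ?sqr_ge0//; lra.
have d0 : n + lam + 1 != 0 by lra.
rewrite /energy /Y' !mdotE.
rewrite (mdotC Y x) (mdotC V x) (mdotC V' x) (mdotC V Y) (mdotC V' Y).
rewrite (mdotC V' V).
by field.
Qed.

(** Splitting n V off the vector squared in [energy] cancels the <Y, V> term; what remains is n^2
    |V|^2 / 2, a square, and n lam times the slack of the hypothesis. *)
Lemma energy_ge lam n x Y V : 0 < n -> 0 <= lam -> mdot V V <= mdot V x ->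
  2^-1 * n ^+ 2 * mdot V V <= energy lam n x Y V.
Proof.
move=> n0 lam0 c.
rewrite -subr_ge0.
set U := lam *: x + (n + lam) *: Y - lam *: V.
suff -> : energy lam n x Y V - 2^-1 * n ^+ 2 * mdot V V =
   n * lam * (mdot V x - mdot V V) + 2^-1 * mdot U U.
  have := mdot_ge0 U.
  by move=> ?; rewrite !addr_ge0// !mulr_ge0//; lra.
rewrite /energy /U !mdotE.
rewrite (mdotC Y x) (mdotC V x) (mdotC V Y).
by field.
Qed.

(** The gap is exactly 2 n^2 times the product assumed nonnegative. *)
Lemma residual_step n alpha Y V V' (Y' := (n / (n + alpha)) *: (Y - V' + V)) :
  0 < n -> 0 < alpha -> 0 <= mdot (V' - V) (Y - V') ->
  (n + alpha) ^+ 2 * mdot Y' Y' + n ^+ 2 * mdot V' V'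
    <= n ^+ 2 * (mdot Y Y + mdot V V).
Proof.
move=> n0 a0 c.
rewrite -subr_ge0.
suff -> : n ^+ 2 * (mdot Y Y + mdot V V) -
   ((n + alpha) ^+ 2 * mdot Y' Y' + n ^+ 2 * mdot V' V') =
   2 * n ^+ 2 * mdot (V' - V) (Y - V').
  by rewrite !mulr_ge0 ?sqr_ge0//; lra.
have d0 : n + alpha != 0 by lra.
rewrite /Y' !mdotE (mdotC V Y) (mdotC V' Y) (mdotC V' V).
by field.
Qed.

(** Each resolvent inclusion says that M (c V) lies in T (w - c V). Monotonicity then gives the
    bound with c |V1 - V2|^2 on the left, and c >= 1. *)
Lemma residual_cocoercive (T : H -> set H) (c : R) (w1 w2 V1 V2 : H) :
  Defs.monotone T -> 1 <= c ->
  preconditioned M T w1 (w1 - c *: V1) ->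
  preconditioned M T w2 (w2 - c *: V2) ->
  mdot (V1 - V2) (V1 - V2) <= mdot (V1 - V2) (w1 - w2).
Proof.
move=> Tm c1 [z1 Tz1 e1] [z2 Tz2 e2].
have {}e1 : z1 = M (c *: V1).
  by apply: (addrI (M (w1 - c *: V1))); rewrite e1 -linearD subrK.
have {}e2 : z2 = M (c *: V2).
  by apply: (addrI (M (w2 - c *: V2))); rewrite e2 -linearD subrK.
have := Tm _ _ _ _ Tz1 Tz2; rewrite e1 e2 -linearB -[inner _ _]/(mdot _ _).
have -> : mdot (w1 - c *: V1 - (w2 - c *: V2)) (c *: V1 - c *: V2) =
  c * (mdot (V1 - V2) (w1 - w2) - c * mdot (V1 - V2) (V1 - V2)).
  rewrite !mdotE (mdotC V1 w1) (mdotC V2 w1) (mdotC V1 w2) (mdotC V2 w2).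
  ring.
rewrite pmulr_rge0; last lra.
have := mdot_ge0 (V1 - V2); nra.
Qed.

Lemma mnorm_le u (c : R) : 0 <= c -> mdot u u <= c ^+ 2 -> mnorm M u <= c.
Proof.
by move=> c0 uc; rewrite -(ger0_norm c0) -sqrtr_sqr; exact: ler_wsqrtr.
Qed.

Lemma mnorm_littleo (u : nat -> H) (h : R^nat) (C : R) :
  (forall k, k.+1%:R ^+ 2 * mdot (u k) (u k) <= C * h k) -> h @ \oo --> 0 ->
  (fun k => mnorm M (u k)) =o_\oo (fun k => k.+1%:R^-1 : R).
Proof.
move=> uh h_cvg0; apply/eqoP => e e0.
have Ch_cvg0 : (fun k => C * h k) @ \oo --> 0.
  by rewrite -(mulr0 C); apply: cvgM h_cvg0; exact: cvg_cst.
near=> k.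
rewrite ger0_norm ?sqrtr_ge0// ger0_norm ?invr_ge0//.
apply: mnorm_le; first by rewrite divr_ge0// ltW.
rewrite expr_div_n ler_pdivlMr ?exprn_gt0// mulrC; apply: le_trans (uh k) _.
by apply: ltW; near: k; apply: cvgr_lt Ch_cvg0 _ _; rewrite exprn_gt0.
Unshelve. all: by end_near. Qed.

(** * Energy and speed along a run *)

Section run.
Context (T : H -> set H) (w0 wstar : H) (alpha rho : R).
Context (w wbar what : nat -> H).
Hypotheses (T_mono : Defs.monotone T) (T_wstar : zeros T wstar).
Hypotheses (alpha_ge2 : 2 <= alpha) (rho_gt0 : 0 < rho) (rho_le2 : rho <= 2).
Hypothesis w_gen : accelerated_dPPM M T w0 alpha rho w wbar what.

(* The factor 1/2 makes the residual 1-cocoercive for every [rho <= 2]. *)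
Definition half_residual k := 2^-1 *: (w k - what k.+1).
Local Notation V := half_residual.

Definition velocity k := w k.+1 - w k + V k.
Local Notation Y := velocity.
Local Notation x k := (w k - wstar).

Lemma half_residualE k : w k - what k.+1 = 2 *: V k.
Proof. by rewrite scalerA divff ?scale1r ?pnatr_eq0. Qed.

(** Relaxation gives 2 V_k = rho (w^k - wbar^k). *)
Lemma run_resolvent k : preconditioned M T (w k) (w k - (2 / rho) *: V k).
Proof.
case: w_gen => _ _ /(_ k)[wbarP whatE _].
suff -> : w k - (2 / rho) *: V k = wbar k by [].
rewrite /V whatE scalerA mulrAC divff ?pnatr_eq0// mul1r.
rewrite -{2}(scale1r (w k)) opprD addrA -scalerBl subKr -scalerBr.
by rewrite scalerA mulVf ?gt_eqF// scale1r subKr.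
Qed.

Lemma run_cocoercive k :
  mdot (V k.+1 - V k) (V k.+1 - V k) <= mdot (V k.+1 - V k) (w k.+1 - w k).
Proof.
apply: (residual_cocoercive T_mono _ (run_resolvent _) (run_resolvent _)).
by rewrite ler_pdivlMr// mul1r.
Qed.

Lemma run_monotone k : 0 <= mdot (V k.+1 - V k) (Y k - V k.+1).
Proof.
have := run_cocoercive k; rewrite -subr_ge0 -mdotNr -mdotDr.
by rewrite opprB addrA.
Qed.

Lemma run_zero k : mdot (V k) (V k) <= mdot (V k) (x k).
Proof.
(* A zero of T is a fixed point of the resolvent, so [wstar] enters the cocoercivity bound with
   residual 0. *)
rewrite -{1 2 3}(subr0 (V k)).
apply: (residual_cocoercive T_mono _ (run_resolvent k)).
  by rewrite ler_pdivlMr// mul1r.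
by exists 0; rewrite ?scaler0 ?subr0 ?addr0.
Qed.

(** At k = 0 the momentum vanishes and the other coefficient is 1/2, so w^1 = w^0 - V_0. *)
Lemma velocity0 : Y 0 = 0.
Proof.
have alpha_neq0 : alpha != 0 by rewrite gt_eqF// (lt_le_trans _ alpha_ge2).
case: w_gen => _ _ /(_ 0%N)[_ _ wE].
rewrite /Y wE mul0r scale0r addr0 [w 0%N + _]addrC addrK /V.
rewrite add0r invfM mulrCA divff//.
by rewrite mulr1 -scalerDr addrA subrK subrr scaler0.
Qed.

Lemma velocityS k :
  Y k.+1 = (k.+1%:R / (k.+1%:R + alpha)) *: (Y k - V k.+1 + V k).
Proof.
have d0 : k.+1%:R + alpha != 0.
  by rewrite gt_eqF// addr_gt0// (lt_le_trans _ alpha_ge2).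
case: w_gen => _ _ /(_ k.+1)[_ _ wE].
have -> : Y k - V k.+1 + V k = V k.+1 + (what k.+2 - what k.+1).
  have -> : what k.+2 = w k.+1 - 2 *: V k.+1 by rewrite -half_residualE subKr.
  have -> : what k.+1 = w k - 2 *: V k by rewrite -half_residualE subKr.
  rewrite opprB (addrC (_ *: V k)) addrACA [RHS]addrCA.
  rewrite /Y -!addrA.
  congr (_ + (_ + _)).
  rewrite !scaler_nat !mulr2n opprD -[- _ - _ + _]addrA addNKr.
  by rewrite addrCA.
rewrite /Y wE -(addrA (w k.+1)) [w k.+1 + _]addrC addrK addrAC [RHS]scalerDr.
congr (_ + _); rewrite -(opprB (w _)) half_residualE -scaleNr scalerA.
rewrite -{2}(scale1r (V k.+1)) -scalerDl; congr (_ *: _).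
by move: (k.+1%:R) d0 => n d0; field.
Qed.

Lemma run_positionS k : x k.+1 = x k + Y k - V k.
Proof. by rewrite /Y [x k + _]addrA addrK addrC addrA subrK. Qed.

Definition run_energy k : R := energy (alpha - 1) k.+1%:R (x k) (Y k) (V k).

Lemma run_energy_ge k :
  2^-1 * k.+1%:R ^+ 2 * mdot (V k) (V k) <= run_energy k.
Proof.
by apply: energy_ge (run_zero k); [exact: ltr0Sn|move: alpha_ge2; lra].
Qed.

Lemma run_energy_ge0 k : 0 <= run_energy k.
Proof.
by apply: le_trans (run_energy_ge k); rewrite !mulr_ge0 ?mdot_ge0 ?exprn_ge0.
Qed.

(** Here lam = n = 1, so the coefficient n - lam of V_0 vanishes, and Y_0 = 0. *)
Lemma run_energy0 : alpha = 2 ->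
  run_energy 0 = 2^-1 * mdot (w0 - wstar) (w0 - wstar).
Proof.
move=> alpha2; rewrite /run_energy alpha2 /energy velocity0.
have -> : 2 - 1 = 1 :> R by lra.
case: w_gen => -> _ _.
rewrite subrr scale0r scaler0 !addr0 scale1r -(scale0r 0) mdotZl.
by rewrite !mul0r mulr0 subr0.
Qed.

Lemma run_energyS k :
  run_energy k.+1 + (alpha - 2) * k.+2%:R * mdot (V k.+1) (V k.+1)
    <= run_energy k.
Proof.
have -> : alpha - 2 = (alpha - 1) - 1 by lra.
rewrite /run_energy -[k.+2%:R]natr1 velocityS.
(* Writes the denominator n + alpha as n + lam + 1, the form in [energy_step]. *)
rewrite -{2}(subrK 1 alpha) [_ + (_ + 1)]addrA run_positionS.
apply: energy_step; rewrite -?run_positionS.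
- by move: alpha_ge2; lra.
- exact: ltr0Sn.
- exact: run_monotone.
- exact: run_zero.
Qed.

Lemma run_energy_le k : run_energy k.+1 <= run_energy k.
Proof.
apply: le_trans (run_energyS k); rewrite lerDl !mulr_ge0 ?mdot_ge0//.
by rewrite subr_ge0.
Qed.

Lemma run_residual_le k : alpha = 2 ->
  mnorm M (w k - what k.+1) <= 2 * mnorm M (w0 - wstar) / k.+1%:R.
Proof.
move=> alpha2; apply: mnorm_le; first by rewrite !mulr_ge0 ?sqrtr_ge0.
rewrite half_residualE mdotZl mdotZr expr_div_n exprMn sqr_sqrtr ?mdot_ge0//.
rewrite ler_pdivlMr ?exprn_gt0// -[inner _ _]/(mdot _ _).
have E_le : run_energy k <= run_energy 0.
  by elim: k => // k; apply: le_trans; exact: run_energy_le.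
have := le_trans (run_energy_ge k) E_le; rewrite run_energy0//; nra.
Qed.

Definition run_speed k : R :=
  k.+1%:R ^+ 2 * (mdot (Y k) (Y k) + mdot (V k) (V k)).

Lemma run_speed_cvg0 : 2 < alpha -> run_speed @ \oo --> 0.
Proof.
(* With n = k + 1, this c turns the energy drop into 4 (n + 1) v. The descent then needs (n + 1)(n +
   2) <= n^2 + 4 (n + 1) for v and (n + 1)(n + 2) <= (n + alpha)^2 for q. *)
move=> alpha_gt2; pose c : R := 4 / (alpha - 2).
have c0 : 0 <= c by rewrite divr_ge0//; lra.
apply: (@descent_cvg0 _ (fun k => c * run_energy k)) => k.
- by rewrite mulr_ge0// run_energy_ge0.
- by rewrite mulr_ge0 ?exprn_ge0// addr_ge0// mdot_ge0.
- by rewrite ler_wpM2l// run_energy_le.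
have := ler_wpM2l c0 (run_energyS k).
rewrite mulrDr !mulrA divfK; last lra.
have := @residual_step k.+1%:R alpha (Y k) (V k) (V k.+1) (ltr0Sn _ _) _
  (run_monotone k).
rewrite -velocityS -/(run_speed k) /(run_speed k.+1).
set q := mdot (Y k.+1) _; set v := mdot (V k.+1) _.
have q0 : 0 <= q by exact: mdot_ge0.
have v0 : 0 <= v by exact: mdot_ge0.
have alpha_gt0 : 0 < alpha by lra.
move=> /(_ alpha_gt0); rewrite -[k.+2%:R]natr1.
move: (k.+1%:R) (ltr0Sn R k) => n n0.
have -> : (n + 1) ^+ 2 * (q + v) / (n + 1) = (n + 1) * (q + v).
  by field; lra.
have : (n + 2) ^+ 2 * q <= (n + alpha) ^+ 2 * q.
  by rewrite ler_wpM2r// lerXn2r ?nnegrE; lra.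
have : 0 <= n * q by rewrite mulr_ge0// ltW.
have : 0 <= n * v by rewrite mulr_ge0// ltW.
nra.
Qed.

Lemma run_littleo : 2 < alpha ->
  (fun k => mnorm M (w k.+1 - w k)) =o_\oo (fun k => k.+1%:R^-1 : R) /\
  (fun k => mnorm M (w k - what k.+1)) =o_\oo (fun k => k.+1%:R^-1 : R).
Proof.
move=> /run_speed_cvg0 h0; split.
  (* The constant 2 comes from |Y - V|^2 <= 2 (|Y|^2 + |V|^2); the 4 below from |2 V|^2. *)
  apply: (@mnorm_littleo _ _ 2) h0 => k.
  have -> : w k.+1 - w k = Y k - V k by rewrite addrK.
  rewrite [leRHS]mulrCA ler_wpM2l ?exprn_ge0//.
  by have := mdot_ge0 (Y k + V k); rewrite !mdotE; lra.
apply: (@mnorm_littleo _ _ 4) h0 => k.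
rewrite half_residualE mdotZl mdotZr [leRHS]mulrCA ler_wpM2l ?exprn_ge0//.
by have := mdot_ge0 (Y k); lra.
Qed.

End run.
End mdot.

Unset Implicit Arguments.

Theorem proposition2p9 (R : realType) (H : hilbertType R)
    (T : H -> set H) (M : {linear H -> H})
    (w0 : H) (alpha rho : R) (w wbar what : nat -> H)
    (T_max : maximal_monotone T) (T_zero : zeros T !=set0)
    (M_adm : admissible_preconditioner M T) (M_closed : closed (range M))
    (alpha_ge2 : 2 <= alpha) (rho_gt0 : 0 < rho) (rho_le2 : rho <= 2)
    (w_gen : accelerated_dPPM M T w0 alpha rho w wbar what) :
  (alpha = 2 ->
     forall (k : nat) (wstar : H), zeros T wstar ->
       mnorm M (w k - what k.+1) <= 2 * mnorm M (w0 - wstar) / k.+1%:R) /\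
  (2 < alpha ->
     (fun k : nat => mnorm M (w k.+1 - w k)) =o_\oo
       (fun k : nat => k.+1%:R^-1 : R) /\
     (fun k : nat => mnorm M (w k - what k.+1)) =o_\oo
       (fun k : nat => k.+1%:R^-1 : R)).
Proof.
have [M_sa M_psd] : self_adjoint M /\ positive_semidefinite M by case: M_adm.
(* The rates in (b) name no zero, but the energy behind them is built on one. *)
have [wstar0 T_wstar0] := T_zero.
have T_mono := T_max.1.
split=> [alpha2 k wstar T_wstar|].
  exact: (run_residual_le M_sa M_psd T_mono T_wstar alpha_ge2 rho_gt0 rho_le2
    w_gen _ alpha2).
exact: (run_littleo M_sa M_psd T_mono T_wstar0 alpha_ge2 rho_gt0 rho_le2 w_gen).
Qed.
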